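(* Fix an integer $k\ge 2$, constants $\alpha>0$, $r>0$, $0<p<1$, and let $X$ be the number of solutions of a random instance of Model RB with parameters $(n,\alpha,r,k,p)$. Let $\tau=\frac{1}{1-p}$ and $r_{cr}=\frac{1}{\ln\tau}$. If $(2k-1)\alpha>1$ and $k\ge \frac{\tau\ln\tau}{\tau-1}$, then $\lim_{n\to\infty}\Pr[X>0]=1$ if $r<r_{cr}$, and $\lim_{n\to\infty}\Pr[X>0]=0$ if $r>r_{cr}$.
   Context: Model RB with parameters $(n,\alpha,r,k,p)$, where $n$ is the number of variables, $\alpha>0$, $r>0$, $k\ge 2$ an integer and $0<p<1$: there are $n$ variables $x_1,\dots,x_n$, each with the same domain $D$ of size $d=n^{\alpha}$ (treated as an integer). A random instance is generated as follows: (1) select, independently with repetition, $t=rn\ln d$ constraints, the scope of each being a set of $k$ distinct variables chosen uniformly at random among the $n$ variables; (2) for each constraint, select uniformly at random without repetition a set of $q=p\,d^{k}$ ''incompatible'' tuples from $D^{k}$ (so the constraint's relation consists of the remaining $(1-p)d^k$ tuples). An assignment of values from $D$ to all variables is a solution if, for every constraint, the tuple of values assigned to its scope is not incompatible. Limits are taken as $n\to\infty$ with $\alpha,r,k,p$ fixed. *)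

(* Defs.v *)
From Stdlib Require Import Reals.
From Coquelicot Require Import Coquelicot.
From mathcomp Require Import all_boot.

Set Implicit Arguments.
Unset Strict Implicit.
Unset Printing Implicit Defensive.

Definition dRB (n : nat) (alpha : R) : nat :=
  Z.to_nat (Int_part (Rpower (INR n) alpha)%R).
Definition tRB (n : nat) (alpha r : R) : nat :=
  Z.to_nat (Int_part (r * INR n * ln (INR (dRB n alpha)))%R).
Definition qRB (n : nat) (alpha : R) (k : nat) (p : R) : nat :=
  Z.to_nat (Int_part (p * INR (dRB n alpha ^ k)%N)%R).

(* A constraint on n variables with domain 'I_d and arity k:
   its scope (a k-set of variables, encoded as the strictly increasing
   enumeration 'I_k -> 'I_n of that set) and its set of incompatible tuples. *)
Definition constraintRB (n d k : nat) : finType :=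
  ({ffun 'I_k -> 'I_n} * {set {ffun 'I_k -> 'I_d}})%type.

Definition valid_constraint (n d k q : nat) (c : constraintRB n d k) : bool :=
  [forall i : 'I_k, forall j : 'I_k, (i < j)%N ==> (c.1 i < c.1 j)%N]
  && (#|c.2| == q).

Definition instanceRB (n d k t : nat) : finType := {ffun 'I_t -> constraintRB n d k}.

Definition valid_instance (n d k q t : nat) (I : instanceRB n d k t) : bool :=
  [forall j : 'I_t, valid_constraint q (I j)].

Definition is_solution (n d k t : nat) (I : instanceRB n d k t)
  (sigma : {ffun 'I_n -> 'I_d}) : bool :=
  [forall j : 'I_t, [ffun i : 'I_k => sigma ((I j).1 i)] \notin (I j).2].

Definition num_solutions (n d k t : nat) (I : instanceRB n d k t) : nat :=
  #|[set sigma : {ffun 'I_n -> 'I_d} | is_solution I sigma]|.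

Definition prob_satRB (n : nat) (alpha r : R) (k : nat) (p : R) : R :=
  let d := dRB n alpha in
  let t := tRB n alpha r in
  let q := qRB n alpha k p in
  (INR #|[set I : instanceRB n d k t | valid_instance q I && (0 < num_solutions I)%N]|
   / INR #|[set I : instanceRB n d k t | valid_instance q I]|)%R.

(* Main.v *)
(** First and second moment method.  Writing [N = d^k], an assignment satisfies a random
    constraint with probability exactly [1 - q/N], so [E X = d^n (1 - q/N)^t], which tends to
    [0] when [r > r_cr].

    For [r < r_cr] one shows [limsup E[X^2] / (E X)^2 <= 1].  For two assignments agreeing on
    [S = s n] variables, with [a = 1/d] and [c = p/(1-p) = tau - 1], sampling the incompatible
    tuples without repetition makes [Pr(both satisfied) / Pr(one satisfied)^2] at most
    [1 + 2 c max(0, s^k - a^k)]: the correlation vanishes at the mean agreement [S = n/d].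
    For [S <= n^(1 + delta - min(alpha,1))] linearizing [s^k - a^k] bounds the [t]-th power by
    [max(1, exp(A (S - n/d)))], whose mean tends to [1] since [n A^2 / d -> 0]; this is where
    [(2k-1) alpha > 1] enters.  For larger [S] the ratio is also at most [1 + c s^k], and
    [k >= tau ln tau / (tau - 1)] gives [ln (1 + c s^k) <= s ln tau], so that its [t]-th power
    is at most [d^((1-eta) S)] with [eta = 1 - r/r_cr].  All averages over the second
    assignment reduce to the generating function [E z^S = (1 - a + a z)^n]. *)
Require Import Defs.
From Stdlib Require Import ZArith Reals Lra.
From Coquelicot Require Import Coquelicot.
From HB Require Import structures.
From mathcomp Require Import all_boot.
Local Open Scope R_scope.

(** * Finite sums of reals and moments by double counting *)

HB.instance Definition _ := Monoid.isComLaw.Build R 0 Rplus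
  (fun x y z => esym (Rplus_assoc x y z)) Rplus_comm Rplus_0_l.
HB.instance Definition _ := Monoid.isComLaw.Build R 1 Rmult
  (fun x y z => esym (Rmult_assoc x y z)) Rmult_comm Rmult_1_l.
HB.instance Definition _ := Monoid.isMulLaw.Build R 0 Rmult Rmult_0_l Rmult_0_r.
HB.instance Definition _ := Monoid.isAddLaw.Build R Rmult Rplus
  (fun x y z => Rmult_plus_distr_r x y z) Rmult_plus_distr_l.

Notation "\Rsum_ ( i | P ) F" := (\big[Rplus/0]_(i | P%B) F)
  (at level 36, F at level 36, i at level 50, format "\Rsum_ ( i  |  P )  F").
Notation "\Rsum_ ( i : T ) F" := (\big[Rplus/0]_(i : T) F)
  (at level 36, F at level 36, i at level 50, format "\Rsum_ ( i  :  T )  F").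

Lemma INR_sum (I : finType) (P : pred I) (F : I -> nat) :
  INR (\sum_(i | P i) F i)%N = \Rsum_(i | P i) INR (F i).
Proof. by apply: (big_morph INR plus_INR). Qed.

Lemma INR_expn (m n : nat) : INR (m ^ n)%N = INR m ^ n.
Proof. by elim: n => [|n IH] //; rewrite expnS mult_INR IH. Qed.

Lemma leq_INR (m n : nat) : (m <= n)%N -> INR m <= INR n.
Proof. by move/leP/le_INR. Qed.

Lemma Rsum_le (I : finType) (P : pred I) (F G : I -> R) :
  (forall i, P i -> F i <= G i) -> \Rsum_(i | P i) F i <= \Rsum_(i | P i) G i.
Proof.
move=> FG; apply: (big_ind2 (fun x y => x <= y)) => //; first exact: Rle_refl.
by move=> *; apply: Rplus_le_compat.
Qed.

Lemma Rsum_mull (I : finType) (P : pred I) (F : I -> R) (c : R) :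
  \Rsum_(i | P i) (c * F i) = c * \Rsum_(i | P i) F i.
Proof. by rewrite big_distrr. Qed.

Lemma Rsum_const (I : finType) (c : R) : \Rsum_(i : I) c = INR #|I| * c.
Proof.
rewrite big_const; elim: #|I| => [|m IH]; first by rewrite /=; lra.
by rewrite iterS IH S_INR; lra.
Qed.

Lemma card_forall_mem (C : finType) (t : nat) (A : {set C}) :
  #|[set I : {ffun 'I_t -> C} | [forall j, I j \in A]]| = (#|A| ^ t)%N.
Proof.
have := card_ffun_on 'I_t (mem A); rewrite card_ord => <-; apply: eq_card => I.
rewrite inE; apply/forallP/ffun_onP => H j; exact: H.
Qed.

(** First moment by exchanging the two sums: for a fixed [g] the [t] constraints are chosen
    independently, which produces a [t]-th power. *)
Lemma sum_num_sat (C G : finType) (t : nat) (V : {set C}) (sat : C -> G -> bool) :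
  (\sum_(I : {ffun 'I_t -> C} | [forall j, I j \in V])
     #|[set g | [forall j, sat (I j) g]]|
   = \sum_g #|[set c in V | sat c g]| ^ t)%N.
Proof.
under [LHS]eq_bigr => I _ do rewrite -sum1dep_card big_mkcond /=.
rewrite exchange_big /=; apply: eq_bigr => g _.
rewrite -card_forall_mem -sum1dep_card -big_mkcondr /=; apply: eq_bigl => I.
apply/andP/forallP => [[/forallP H1 /forallP H2] j | H].
  by rewrite inE H1 H2.
by split; apply/forallP => j; have := H j; rewrite inE => /andP[].
Qed.

(** The square counts ordered pairs of solutions, so this is the first moment identity with [G * G]
    in place of [G]. *)
Lemma sum_num_sat_sqr (C G : finType) (t : nat) (V : {set C}) (sat : C -> G -> bool) :
  (\sum_(I : {ffun 'I_t -> C} | [forall j, I j \in V])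
     #|[set g | [forall j, sat (I j) g]]| ^ 2
   = \sum_g \sum_h #|[set c in V | sat c g && sat c h]| ^ t)%N.
Proof.
rewrite pair_big /= -(sum_num_sat _ _ t V (fun c gh => sat c gh.1 && sat c gh.2)).
apply: eq_bigr => I _; rewrite -mulnn -cardsX; apply: eq_card => -[g h].
rewrite !inE /=; apply/andP/forallP => [[/forallP H1 /forallP H2] j | H].
  by rewrite H1 H2.
by split; apply/forallP => j; have /andP[] := H j.
Qed.

(** Markov's inequality in counting form. *)
Lemma card_pos_le_sum (T : finType) (P : pred T) (X : T -> nat) :
  INR #|[set x | P x && (0 < X x)%N]| <= INR (\sum_(x | P x) X x)%N.
Proof.
apply: leq_INR; rewrite -sum1dep_card big_mkcondr /=; apply: leq_sum => x _.
by case: (X x).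
Qed.

(* On [X > 0] this is [(1 - l X)^2 >= 0]. *)
Lemma card_pos_ge (T : finType) (P : pred T) (X : T -> nat) (l : R) :
  2 * l * INR (\sum_(x | P x) X x)%N - l * l * INR (\sum_(x | P x) X x ^ 2)%N
  <= INR #|[set x | P x && (0 < X x)%N]|.
Proof.
rewrite -sum1dep_card big_mkcondr /= !INR_sum.
suff H : 2 * l * \Rsum_(x | P x) INR (X x) <=
   \Rsum_(x | P x) (INR (if (0 < X x)%N then 1 else 0)%N + l * l * INR (X x ^ 2)%N).
  by move: H; rewrite big_split /= Rsum_mull; lra.
rewrite -Rsum_mull; apply: Rsum_le => x _; rewrite INR_expn.
case: (X x) => [|m]; first by rewrite /=; lra.
have := Rle_0_sqr (1 - l * INR m.+1); rewrite /Rsqr.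
change (INR (if (0 < m.+1)%N then 1%N else 0%N)) with 1; nra.
Qed.

(** The weight factors over coordinates: at each one, a single value of [h] agrees with [g] and
    contributes [z], while the other [d - 1] values contribute [1]. *)
Lemma sum_pow_agree (n d : nat) (g : {ffun 'I_n -> 'I_d}) (z : R) :
  \Rsum_(h : {ffun 'I_n -> 'I_d}) z ^ #|[set i | g i == h i]|
  = (INR d - 1 + z) ^ n.
Proof.
pose F i (v : 'I_d) := if g i == v then z else 1.
transitivity (\big[Rmult/1]_(i < n) \Rsum_(v : 'I_d) F i v).
  rewrite bigA_distr_bigA /=; apply: eq_bigr => h _.
  rewrite /F -big_mkcond /= big_const cardsE.
  by elim: #|_| => //= m ->.
rewrite (eq_bigr (fun=> INR d - 1 + z)) => [|i _].
  by rewrite big_const card_ord; elim: n {g F} => //= n ->.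
rewrite (bigD1 (g i)) //= {1}/F eqxx.
rewrite (eq_bigr (fun=> 1)) => [|v]; last by rewrite /F eq_sym; case: eqP.
have -> : \Rsum_(v | v != g i) 1 = INR d - 1; last lra.
have := Rsum_const 'I_d 1; rewrite (bigD1 (g i)) //= card_ord; lra.
Qed.

(** * Counting scopes and constraints *)

Lemma sorted_enum_ord (n : nat) (A : {pred 'I_n}) :
  sorted (relpre val ltn) (enum A).
Proof.
rewrite /enum_mem; apply: sorted_filter; first by move=> x y z; apply: ltn_trans.
by rewrite -enumT -sorted_map val_enum_ord iota_ltn_sorted.
Qed.

Definition scope_set (n k : nat) (A : {set 'I_n}) : {set {ffun 'I_k -> 'I_n}} :=
  [set f : {ffun 'I_k -> 'I_n} |
    [forall i : 'I_k, forall j : 'I_k, (i < j)%N ==> (f i < f j)%N]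
    && [forall i, f i \in A]].

(** Taking images is a bijection from increasing maps into [A] to [k]-subsets of [A]; its inverse
    enumerates a subset in increasing order. *)
Lemma card_scope_set (n k : nat) (A : {set 'I_n}) : #|scope_set n k A| = 'C(#|A|, k).
Proof.
pose im (f : {ffun 'I_k -> 'I_n}) := f @: 'I_k.
have incP (f : {ffun 'I_k -> 'I_n}) : f \in scope_set n k A ->
    {homo f : i j / (i < j)%N} /\ forall i, f i \in A.
  rewrite inE => /andP[/forallP H /forallP HA]; split=> // i j.
  by move/forallP: (H i) => /(_ j) /implyP.
have im_inj : {in scope_set n k A &, injective im}.
  move=> f g /incP[Hf _] /incP[Hg _] Efg.
  (* Both lists are strictly sorted and have the same members, hence coincide. *)
  have E : map f (enum 'I_k) = map g (enum 'I_k).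
    apply: (@irr_sorted_eq _ (relpre val ltn)).
    - by move=> x y z; apply: ltn_trans.
    - by move=> x; apply: ltnn.
    - by apply: (homo_sorted (e := relpre val ltn)) (sorted_enum_ord _ _) => i j; apply: Hf.
    - by apply: (homo_sorted (e := relpre val ltn)) (sorted_enum_ord _ _) => i j; apply: Hg.
    - move=> y; have : (y \in im f) = (y \in im g) by rewrite Efg.
      have memE (h : {ffun 'I_k -> 'I_n}) : (y \in im h) = (y \in map h (enum 'I_k)).
        apply/imsetP/mapP => -[x _ ->]; exists x => //; exact: mem_enum.
      by rewrite !memE.
  apply/ffunP => i; move/eq_in_map: E; apply; exact: mem_enum.
rewrite -(card_in_imset im_inj) -cards_draws; apply: eq_card => B.
rewrite inE; apply/imsetP/andP => [[f Hf ->]|[/subsetP BA /eqP cB]].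
  have [Hinc HA] := incP f Hf; split.
    by apply/subsetP => y /imsetP[i _ ->].
  rewrite card_imset ?card_ord // => i j Eij; apply/val_inj/eqP.
  by case: ltngtP => // /Hinc; rewrite Eij ltnn.
pose f := [ffun i : 'I_k => enum_val (cast_ord (esym cB) i)].
have fB i : f i \in B by rewrite ffunE; apply: enum_valP.
exists f.
  rewrite inE; apply/andP; split; last by apply/forallP => i; apply: BA.
  apply/forallP => i; apply/forallP => j; apply/implyP => ij.
  have [x0 _] : exists x0 : 'I_n, True by exists (f i).
  rewrite !ffunE !(enum_val_nth x0).
  have tr : transitive (relpre (val : 'I_n -> nat) ltn) by move=> x y z; apply: ltn_trans.
  apply: (sorted_ltn_nth tr x0 (sorted_enum_ord n B)) => //;
    by rewrite inE -cardE [X in (_ < X)%N]cB /=; apply: ltn_ord.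
apply/setP => y; apply/idP/imsetP => [yB|[i _ ->]] //.
exists (cast_ord cB (enum_rank_in yB y)) => //.
by rewrite ffunE cast_ordK enum_rankK_in.
Qed.

(** Factor by factor, [(S - i) / (n - i) <= S / n]. It bounds by [(S / n) ^ k] the probability that
    a random scope lies inside a given set of [S] variables. *)
Lemma bin_mul_expn_le (n S k : nat) : (S <= n)%N -> ('C(S, k) * n ^ k <= 'C(n, k) * S ^ k)%N.
Proof.
move=> Sn; rewrite -(leq_pmul2l (fact_gt0 k)).
rewrite mulnA [(k`! * _)%N]mulnC bin_ffact mulnA [(k`! * 'C(n, k))%N]mulnC bin_ffact.
elim: k => [|k IH]; first by rewrite !ffactn0.
rewrite !ffactnSr !expnSr.
rewrite [(_ * _ * (_ * n))%N]mulnACA [leqRHS]mulnACA leq_mul //.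
have -> : ((S - k) * n = S * n - k * n)%N by rewrite mulnBl.
have -> : ((n - k) * S = S * n - k * S)%N by rewrite mulnBl mulnC.
by rewrite leq_sub2l // leq_mul2l Sn orbT.
Qed.

Lemma card_pair_pred (A B : finType) (P : pred (A * B)) :
  #|[set c | P c]| = (\sum_a #|[set b | P (a, b)]|)%N.
Proof.
rewrite -sum1dep_card (eq_bigr (fun a => \sum_(b | P (a, b)) 1)%N) => [|a _].
  by rewrite pair_big_dep /=; apply: eq_big => -[].
by rewrite sum1dep_card.
Qed.

Lemma card_draws_disjoint (T : finType) (U : {set T}) (q : nat) :
  #|[set B : {set T} | (#|B| == q) && [disjoint U & B]]| = 'C(#|T| - #|U|, q).
Proof.
have <- : #|~: U| = (#|T| - #|U|)%N by rewrite -(cardsC U) addKn.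
rewrite -cards_draws; apply: eq_card => B.
by rewrite !inE andbC disjoint_sym disjoints_subset.
Qed.

Definition sat_constraint (n d k : nat) (c : constraintRB n d k)
  (sigma : {ffun 'I_n -> 'I_d}) : bool :=
  [ffun i : 'I_k => sigma (c.1 i)] \notin c.2.

Definition agree_set (n d : nat) (sigma tau : {ffun 'I_n -> 'I_d}) : {set 'I_n} :=
  [set i | sigma i == tau i].

Lemma agree_set_refl (n d : nat) (sigma : {ffun 'I_n -> 'I_d}) :
  agree_set n d sigma sigma = setT.
Proof. by apply/setP => i; rewrite !inE eqxx. Qed.

Lemma card_tuples (d k : nat) : #|{: {ffun 'I_k -> 'I_d}}| = (d ^ k)%N.
Proof. by rewrite card_ffun !card_ord. Qed.

Lemma card_valid (n d k q : nat) :
  #|[set c : constraintRB n d k | valid_constraint q c]| = ('C(n, k) * 'C(d ^ k, q))%N.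
Proof.
rewrite card_pair_pred /valid_constraint /=.
have -> : 'C(n, k) = #|scope_set n k setT| by rewrite card_scope_set cardsT card_ord.
rewrite -sum_nat_const [RHS]big_mkcond /=; apply: eq_bigr => f _.
rewrite inE; have -> : [forall i, f i \in [set: 'I_n]] by apply/forallP => i; rewrite inE.
rewrite andbT; case: ifP => _ /=; last by rewrite -(cards0 {set {ffun 'I_k -> 'I_d}});
  apply: eq_card => B; rewrite !inE.
by rewrite -card_tuples -card_draws.
Qed.

(** If the scope lies in the agreement set, both assignments induce the same tuple and only one
    tuple must be avoided; otherwise the induced tuples differ and two must be avoided. *)
Lemma card_valid_sat2 (n d k q : nat) (sigma tau : {ffun 'I_n -> 'I_d}) :
  let J := 'C(#|agree_set n d sigma tau|, k) in
  #|[set c : constraintRB n d k in [set c | valid_constraint q c] |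
       sat_constraint n d k c sigma && sat_constraint n d k c tau]|
  = (J * 'C(d ^ k - 1, q) + ('C(n, k) - J) * 'C(d ^ k - 2, q))%N.
Proof.
set A := agree_set _ _ _ _ => J.
have JE : J = #|scope_set n k A| by rewrite card_scope_set.
have nE : 'C(n, k) = #|scope_set n k setT| by rewrite card_scope_set cardsT card_ord.
have sub : scope_set n k A \subset scope_set n k setT.
  apply/subsetP => f; rewrite !inE => /andP[-> _] /=.
  by apply/forallP => i; rewrite inE.
have -> : ('C(n, k) - J = #|scope_set n k setT :\: scope_set n k A|)%N.
  by rewrite nE JE cardsD (setIidPr sub).
rewrite JE -!sum_nat_const [X in (X + _)%N]big_mkcond [X in (_ + X)%N]big_mkcond /=.
rewrite -big_split card_pair_pred /=; apply: eq_bigr => f _.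
rewrite /valid_constraint /sat_constraint /= [in RHS]in_setD.
have fT : (f \in scope_set n k setT) =
   [forall i : 'I_k, forall j : 'I_k, (i < j)%N ==> (f i < f j)%N].
  by rewrite inE; have -> : [forall i, f i \in [set: 'I_n]]
    by [apply/forallP => i; rewrite inE]; rewrite andbT.
pose u := [ffun i : 'I_k => sigma (f i)]; pose v := [ffun i : 'I_k => tau (f i)].
transitivity (if f \in scope_set n k setT then 'C(d ^ k - #|[set u; v]|, q) else 0)%N.
  rewrite fT; case: ifP => fi; last first.
    rewrite -(cards0 {set {ffun 'I_k -> 'I_d}}); apply: eq_card => B.
    by rewrite !inE /= fi.
  rewrite -card_tuples -card_draws_disjoint; apply: eq_card => B.
  by rewrite !inE /= fi /= disjoints_subset subUset !sub1set !inE.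
rewrite cards2.
have uvE : f \in scope_set n k setT -> (u != v) = (f \notin scope_set n k A).
  move=> fs; rewrite !inE -fT fs /=; congr negb; apply/eqP/forallP => [E i|H].
    by rewrite inE; move/ffunP/(_ i): E; rewrite !ffunE => ->.
  by apply/ffunP => i; rewrite !ffunE; have := H i; rewrite inE => /eqP.
case: (boolP (f \in scope_set n k setT)) => fs; last first.
  have /negbTE -> : f \notin scope_set n k A by apply: contra fs => /(subsetP sub).
  by rewrite andbF.
by rewrite uvE //; case: (f \in scope_set n k A); rewrite /= ?addn0.
Qed.

(** * First and second moment bounds *)

(** This is [prob_satRB] with [d], [q] and [t] left free, so that the moment bounds can be stated
    without rounding. *)
Definition prob_sat (n d k q t : nat) : R :=
  INR #|[set I : instanceRB n d k t | valid_instance q I && (0 < num_solutions I)%N]|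
  / INR #|[set I : instanceRB n d k t | valid_instance q I]|.

Lemma card_valid_instance (n d k q t : nat) :
  #|[set I : instanceRB n d k t | valid_instance q I]| = (('C(n, k) * 'C(d ^ k, q)) ^ t)%N.
Proof.
rewrite -card_valid -card_forall_mem; apply: eq_card => I; rewrite !inE /valid_instance.
by apply: eq_forallb => j; rewrite inE.
Qed.

Lemma card_valid_sat (n d k q : nat) (sigma : {ffun 'I_n -> 'I_d}) :
  #|[set c : constraintRB n d k in [set c | valid_constraint q c] |
       sat_constraint n d k c sigma]| = ('C(n, k) * 'C(d ^ k - 1, q))%N.
Proof.
have := card_valid_sat2 n d k q sigma sigma; rewrite agree_set_refl cardsT card_ord /= subnn.
by rewrite mul0n addn0 => <-; apply: eq_card => c; rewrite !inE andbb.
Qed.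

Lemma sum_num_solutions (n d k q t : nat) :
  (\sum_(I : instanceRB n d k t | valid_instance q I) num_solutions I
   = d ^ n * ('C(n, k) * 'C(d ^ k - 1, q)) ^ t)%N.
Proof.
transitivity (\sum_(g : {ffun 'I_n -> 'I_d}) #|[set c : constraintRB n d k in
   [set c | valid_constraint q c] | sat_constraint n d k c g]| ^ t)%N.
  rewrite -sum_num_sat; apply: eq_big => // I.
  by apply: eq_forallb => j; rewrite inE.
under eq_bigr => g _ do rewrite card_valid_sat.
by rewrite sum_nat_const card_ffun !card_ord.
Qed.

Lemma sum_num_solutions_sqr (n d k q t : nat) :
  (\sum_(I : instanceRB n d k t | valid_instance q I) num_solutions I ^ 2
   = \sum_(g : {ffun 'I_n -> 'I_d}) \sum_(h : {ffun 'I_n -> 'I_d})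
       #|[set c : constraintRB n d k in [set c | valid_constraint q c] |
          sat_constraint n d k c g && sat_constraint n d k c h]| ^ t)%N.
Proof.
rewrite -sum_num_sat_sqr; apply: eq_big => // I.
by apply: eq_forallb => j; rewrite inE.
Qed.

(** A fixed tuple escapes [q] incompatible ones out of [N] with probability exactly [1 - q / N]. *)
Lemma INR_bin_pred (N q : nat) : (q <= N)%N ->
  INR N * INR 'C(N - 1, q) = (INR N - INR q) * INR 'C(N, q).
Proof.
move=> qN; rewrite subn1 -mult_INR; have -> : (N * 'C(N.-1, q))%coq_nat = (N * 'C(N.-1, q))%N by [].
rewrite mul_bin_down mult_INR minus_INR //; exact/leP.
Qed.

Lemma ltn_INR (m n : nat) : (m < n)%N -> INR m < INR n.
Proof. by move/ltP/lt_INR. Qed.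

Lemma prob_sat_le (n d k q t : nat) : (k <= n)%N -> (q < d ^ k)%N ->
  prob_sat n d k q t <= INR d ^ n * (1 - INR q / INR (d ^ k)) ^ t.
Proof.
move=> kn qN; rewrite /prob_sat card_valid_instance.
set N := (d ^ k)%N in qN *.
have N0 : 0 < INR N by have := ltn_INR _ _ qN; have := pos_INR q; lra.
have K0 : 0 < INR 'C(n, k) by apply: (ltn_INR 0); rewrite bin_gt0.
have C0 : 0 < INR 'C(N, q) by apply: (ltn_INR 0); rewrite bin_gt0 ltnW.
have W0 : 0 < INR (('C(n, k) * 'C(N, q)) ^ t).
  by rewrite INR_expn mult_INR; apply: pow_lt; nra.
apply: (Rmult_le_reg_r _ _ _ W0); rewrite /Rdiv Rmult_assoc Rinv_l ?Rmult_1_r; last lra.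
apply: Rle_trans (card_pos_le_sum _ _ _) _; rewrite sum_num_solutions mult_INR !INR_expn.
rewrite Rmult_assoc -Rpow_mult_distr; right; congr (_ * _ ^ _).
rewrite !mult_INR -(INR_expn d k) -/N; apply: (Rmult_eq_reg_l (INR N)); last lra.
transitivity (INR 'C(n, k) * (INR N * INR 'C(N - 1, q))); first ring.
by rewrite (INR_bin_pred _ _ (ltnW qN)); field; lra.
Qed.

(* The ratio [Pr(both satisfied) / Pr(one satisfied) ^ 2] for a single random constraint
   and two assignments agreeing on [S] variables. *)
Definition pair_ratio (n k N q S : nat) : R :=
  1 + INR q / (INR N - INR q) *
      ((INR 'C(S, k) / INR 'C(n, k) * INR N - 1) / (INR N - 1)).

(** The hypothesis on [b] says that [E[X^2] / (E X)^2 <= b], conditionally on each first assignment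
    [g]. *)
Lemma prob_sat_ge (n d k q t : nat) (b : R) : (k <= n)%N -> (q < d ^ k)%N -> (1 < d ^ k)%N ->
  (forall g : {ffun 'I_n -> 'I_d},
    \Rsum_(h : {ffun 'I_n -> 'I_d}) pair_ratio n k (d ^ k) q #|agree_set n d g h| ^ t
    <= b * INR d ^ n) ->
  2 - b <= prob_sat n d k q t.
Proof.
move=> kn qN N1 Hb; rewrite /prob_sat card_valid_instance.
set pos := #|_|.
set N := (d ^ k)%N in qN N1 Hb *.
have N1' : 1 < INR N by apply: (ltn_INR 1).
have qN' := ltn_INR _ _ qN.
have K0 : 0 < INR 'C(n, k) by apply: (ltn_INR 0); rewrite bin_gt0.
have C0 : 0 < INR 'C(N, q) by apply: (ltn_INR 0); rewrite bin_gt0 ltnW.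
have C10 : 0 < INR 'C(N - 1, q).
  by apply: (ltn_INR 0); rewrite bin_gt0 -ltnS subn1 prednK // ltnW.
have D0 : 0 < INR d ^ n.
  apply/pow_lt/(ltn_INR 0); rewrite lt0n; apply/eqP => d0; move: N1.
  by rewrite /N d0; case: (k) => // k'; rewrite exp0n.
(* [v] counts the valid constraints and [v1] those satisfied by one fixed assignment. *)
pose v := INR 'C(n, k) * INR 'C(N, q); pose v1 := INR 'C(n, k) * INR 'C(N - 1, q).
have v0 : 0 < v by rewrite /v; nra.
have v10 : 0 < v1 by rewrite /v1; nra.
have W0 := pow_lt _ t v0; have V0 := pow_lt _ t v10.
(* [l] is [1 / E X], so that [2 l E X - l^2 E[X^2]] becomes [2 - E[X^2] / (E X)^2]. *)
pose l := v ^ t / (INR d ^ n * v1 ^ t).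
have := card_pos_ge _ (fun I : instanceRB n d k t => valid_instance q I)
  (fun I => num_solutions I) l.
rewrite -/pos sum_num_solutions sum_num_solutions_sqr mult_INR !INR_expn !mult_INR -/N -/v -/v1.
set S2 := INR (\sum_g _)%N.
have HS2 : v ^ t * S2 <= b * (INR d ^ n) ^ 2 * (v1 ^ t) ^ 2.
  rewrite /S2 INR_sum -Rsum_mull.
  have -> : b * (INR d ^ n) ^ 2 * (v1 ^ t) ^ 2 =
     \Rsum_(g : {ffun 'I_n -> 'I_d}) (b * INR d ^ n * (v1 ^ t) ^ 2).
    by rewrite Rsum_const card_ffun !card_ord INR_expn; ring.
  apply: Rsum_le => g _; rewrite INR_sum -Rsum_mull.
  have := Rmult_le_compat_r ((v1 ^ t) ^ 2) _ _ (pow2_ge_0 _) (Hb g).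
  rewrite [X in X <= _]Rmult_comm -Rsum_mull; apply: Rle_trans; right.
  apply: eq_bigr => h _; rewrite INR_expn card_valid_sat2 -/N.
  rewrite -Rpow_mult_distr -pow_mult [(t * 2)%coq_nat]Nat.mul_comm pow_mult -Rpow_mult_distr.
  congr (_ ^ _); set S := #|_|.
  have JK : ('C(S, k) <= 'C(n, k))%N.
    by apply: leq_bin2l; rewrite -[leqRHS](card_ord n) max_card.
  rewrite plus_INR !mult_INR minus_INR; last exact/leP.
  have E1 := INR_bin_pred _ _ (ltnW qN).
  have E2 : (INR N - 1) * INR 'C(N - 2, q) = (INR N - 1 - INR q) * INR 'C(N - 1, q).
    have -> : (N - 2 = N - 1 - 1)%N by rewrite -subnDA.
    have <- : INR (N - 1) = INR N - 1 by rewrite minus_INR //; apply/leP/ltnW.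
    by apply: INR_bin_pred; rewrite -ltnS subn1 prednK // ltnW.
  have F1 : INR 'C(N, q) = INR N / (INR N - INR q) * INR 'C(N - 1, q).
    by apply: (Rmult_eq_reg_l (INR N - INR q)); [rewrite -E1; field | ]; lra.
  have F2 : INR 'C(N - 2, q) = (INR N - 1 - INR q) / (INR N - 1) * INR 'C(N - 1, q).
    by apply: (Rmult_eq_reg_l (INR N - 1)); [rewrite E2; field | ]; lra.
  by rewrite /pair_ratio /v /v1 F1 F2; field; lra.
move=> Hp; apply: (Rmult_le_reg_r _ _ _ W0).
rewrite /Rdiv Rmult_assoc Rinv_l ?Rmult_1_r; last lra.
apply: Rle_trans Hp.
have -> : 2 * l * (INR d ^ n * v1 ^ t) = 2 * v ^ t by rewrite /l; field; lra.
have -> : l * l * S2 = v ^ t * ((v ^ t * S2) / ((INR d ^ n) ^ 2 * (v1 ^ t) ^ 2)).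
  by rewrite /l; field; lra.
have : (v ^ t * S2) / ((INR d ^ n) ^ 2 * (v1 ^ t) ^ 2) <= b.
  have P1 := pow_lt _ 2 D0; have P2 := pow_lt _ 2 V0.
  by apply/Rle_div_l; [nra | lra].
nra.
Qed.

(** * Real inequalities *)

Lemma derive_nonneg_le (f f' : R -> R) (a b : R) : a <= b ->
  (forall x, a <= x <= b -> is_derive f x (f' x)) ->
  (forall x, a <= x <= b -> 0 <= f' x) -> f a <= f b.
Proof.
move=> ab Df f'0.
have [||x [Hx E]] := MVT_gen f a b f'.
- by rewrite Rmin_left ?Rmax_right // => x Hx; apply: Df; lra.
- rewrite Rmin_left ?Rmax_right // => x Hx; apply/continuity_pt_filterlim.
  by apply: ex_derive_continuous; exists (f' x); apply: Df.
- move: Hx; rewrite Rmin_left ?Rmax_right // => Hx.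
  by have := f'0 x Hx; nra.
Qed.

Lemma ln_1p_le (x : R) : -1 < x -> ln (1 + x) <= x.
Proof.
move=> x1; rewrite -{2}(ln_exp x); apply: ln_le; first lra.
exact: exp_ineq1_le.
Qed.

(** The derivative is [(x - ln (1 + x)) / x^2 >= 0]. Hence the lower bound on [k], assumed at [c],
    also holds at every smaller positive [u]. *)
Lemma ln_1p_chord (u c : R) : 0 < u -> u <= c ->
  (1 + u) * ln (1 + u) / u <= (1 + c) * ln (1 + c) / c.
Proof.
move=> u0 uc.
apply: (derive_nonneg_le (fun x => (1 + x) * ln (1 + x) / x)
          (fun x => (x - ln (1 + x)) / (x * x))) => // x Hx.
  by auto_derive; [split; [lra|split; [lra|done]] | field; lra].
apply/Rle_div_r; first nra.
by have := ln_1p_le x; lra.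
Qed.

(** The quotient [ln (1 + c x^k) / x] is nondecreasing on [(0, 1]], and the claim compares [x = s]
    with [x = 1]. The sign of its derivative is governed by [k >= (1 + u) ln (1 + u) / u] at
    [u = c x^k]. *)
Lemma ln_1p_pow_le (k : nat) (c s : R) : 0 < c -> (1 + c) * ln (1 + c) / c <= INR k ->
  0 < s <= 1 -> ln (1 + c * s ^ k) <= s * ln (1 + c).
Proof.
move=> c0 Hk [s0 s1].
have k1 : (0 < k)%N.
  case: k Hk => //= Hk.
  have L : 0 < ln (1 + c) by rewrite -ln_1; apply: ln_increasing; lra.
  have : 0 < (1 + c) * ln (1 + c) / c by apply: Rdiv_lt_0_compat => //; nra.
  lra.
suff H : ln (1 + c * s ^ k) / s <= ln (1 + c * 1 ^ k) / 1.
  move: H; rewrite pow1 Rmult_1_r Rdiv_1_r => H.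
  by move/(Rle_div_l _ _ _ s0): H; lra.
apply: (derive_nonneg_le (fun x => ln (1 + c * x ^ k) / x) (fun x =>
   (INR k * (c * x ^ k) / (1 + c * x ^ k) - ln (1 + c * x ^ k)) / (x * x))) => // x Hx.
  have P : 0 < x ^ k by apply: pow_lt; lra.
  have U : 0 < c * x ^ k by nra.
  auto_derive; first by split; [lra | split; [lra | done]].
  have E : x ^ k = x * x ^ k.-1 by case: (k) k1.
  rewrite E in U *.
  have P' : 0 < x ^ k.-1 by apply: pow_lt; lra.
  by field; lra.
have P : 0 < x ^ k by apply: pow_lt; lra.
have P1 : x ^ k <= 1 by rewrite -(pow1 k); apply: pow_incr; lra.
apply/Rle_div_r; first nra.
have U0 : 0 < c * x ^ k by nra.
have := ln_1p_chord (c * x ^ k) c U0 ltac:(nra) => /Rle_trans /(_ Hk).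
move/(Rle_div_l _ _ _ U0) => H.
suff : ln (1 + c * x ^ k) <= INR k * (c * x ^ k) / (1 + c * x ^ k) by lra.
by apply/Rle_div_r; lra.
Qed.

(** A mean value bound whose slope depends on [y] only, hence is uniform over all [s <= y]. The
    induction splits the next difference as [s (s^(k+1) - a^(k+1)) + a^(k+1) (s - a)]. *)
Lemma pow_sub_le (k : nat) (a s y : R) : 0 <= a -> a <= s -> s <= y ->
  s ^ k.+1 - a ^ k.+1 <= INR k.+1 * y ^ k * (s - a).
Proof.
move=> a0 as_ sy; elim: k => [|k IH]; first by rewrite /=; lra.
have H1 : a ^ k.+1 <= y ^ k.+1 by apply: pow_incr; lra.
have H0 : a ^ k.+1 <= s ^ k.+1 by apply: pow_incr; lra.
rewrite S_INR [s ^ k.+2]/= -[s * s ^ k]/(s ^ k.+1) [a ^ k.+2]/= -[a * a ^ k]/(a ^ k.+1).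
have E : y ^ k.+1 = y * y ^ k by [].
have : s * (s ^ k.+1 - a ^ k.+1) <= y * (INR k.+1 * y ^ k * (s - a)).
  by apply: Rmult_le_compat; lra.
have : a ^ k.+1 * (s - a) <= y ^ k.+1 * (s - a) by apply: Rmult_le_compat_r; lra.
rewrite E; lra.
Qed.

Lemma pow_exp (x : R) (n : nat) : exp x ^ n = exp (INR n * x).
Proof.
elim: n => [|n IH]; first by rewrite /= Rmult_0_l exp_0.
by rewrite [_ ^ _.+1]/= IH -exp_plus S_INR; congr exp; ring.
Qed.

Lemma exp_le (x y : R) : x <= y -> exp x <= exp y.
Proof. by case=> [/exp_increasing/Rlt_le|->] //; apply: Rle_refl. Qed.

Lemma pow_1p_le_exp (x : R) (n : nat) : -1 <= x -> (1 + x) ^ n <= exp (INR n * x).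
Proof.
move=> x0; rewrite -pow_exp; apply: pow_incr; split; first lra.
exact: exp_ineq1_le.
Qed.

Lemma pow_exp_ln (x : R) (n : nat) : 0 < x -> x ^ n = exp (INR n * ln x).
Proof. by move=> x0; rewrite -pow_exp exp_ln. Qed.

(** * The pair correlation *)

Lemma bin_ratio_bounds (n k S : nat) : (0 < n)%N -> (k <= n)%N -> (S <= n)%N ->
  0 <= INR 'C(S, k) / INR 'C(n, k) <= (INR S / INR n) ^ k /\ (INR S / INR n) ^ k <= 1.
Proof.
move=> n0 kn Sn.
have N0 : 0 < INR n by apply: (ltn_INR 0).
have K0 : 0 < INR 'C(n, k) by apply: (ltn_INR 0); rewrite bin_gt0.
have SN : INR S <= INR n by apply: leq_INR.
have s0 : 0 <= INR S / INR n by apply: Rdiv_le_0_compat => //; apply: pos_INR.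
split; first split.
- by apply: Rdiv_le_0_compat => //; apply: pos_INR.
- apply/Rle_div_l => //; have := leq_INR _ _ (bin_mul_expn_le n S k Sn).
  rewrite !mult_INR !INR_expn => H.
  rewrite /Rdiv Rpow_mult_distr pow_inv.
  apply: (Rmult_le_reg_r (INR n ^ k)); first exact: pow_lt.
  apply: Rle_trans H _; right; field; exact/pow_nonzero/Rgt_not_eq.
- rewrite -(pow1 k); apply: pow_incr; split=> //.
  by apply/Rle_div_l => //; lra.
Qed.

(** Put [f = C(S, k) / C(n, k) <= s^k]. The odds [q / (N - q)] are at most [c]. Then
    [(f N - 1) / (N - 1) <= f] because [f <= 1], and the factor [2] of the last bound comes from
    [N / (N - 1) <= 2]. *)
Lemma pair_ratio_bounds (n k N q S : nat) (p : R) : (0 < n)%N -> (k <= n)%N -> (S <= n)%N ->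
  (1 < N)%N -> (q < N)%N -> p < 1 -> INR q <= p * INR N ->
  let c := p / (1 - p) in
  let s := INR S / INR n in
  0 <= pair_ratio n k N q S /\
  pair_ratio n k N q S <= 1 + c * s ^ k /\
  pair_ratio n k N q S <= 1 + 2 * c * Rmax 0 (s ^ k - / INR N).
Proof.
move=> n0 kn Sn N1 qN p1 qp c s.
have [[f0 fs] s1] := bin_ratio_bounds n k S n0 kn Sn.
rewrite -/s in fs s1; rewrite /pair_ratio; set f := _ / INR 'C(n, k) in f0 fs *.
have N2 : 2 <= INR N by apply: (leq_INR 2).
have qN1 : INR q + 1 <= INR N by rewrite -S_INR; apply: leq_INR.
have q0 := pos_INR q.
set Q := INR N in N2 qN1 qp *; set z := INR q in q0 qN1 qp *.
have cz : z / (Q - z) <= c.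
  rewrite /c; apply/Rle_div_l; first lra.
  have -> : p / (1 - p) * (Q - z) = (p * (Q - z)) / (1 - p) by field; lra.
  apply/Rle_div_r; first lra.
  nra.
have c0 : 0 <= z / (Q - z) by apply: Rdiv_le_0_compat; lra.
have iQ : 0 < / Q by apply: Rinv_0_lt_compat; lra.
split; last split.
- have -> : 1 + z / (Q - z) * ((f * Q - 1) / (Q - 1)) =
     (Q * (Q - 1 - z + z * f)) / ((Q - z) * (Q - 1)) by field; lra.
  apply: Rdiv_le_0_compat; last by apply: Rmult_lt_0_compat; lra.
  have zf := Rmult_le_pos _ _ q0 f0.
  by apply: Rmult_le_pos; lra.
- suff : z / (Q - z) * ((f * Q - 1) / (Q - 1)) <= c * s ^ k by lra.
  apply: (Rle_trans _ (z / (Q - z) * s ^ k)); last by apply: Rmult_le_compat_r; lra.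
  apply: Rmult_le_compat_l => //; apply/Rle_div_l; first lra.
  nra.
- have m0 := Rmax_l 0 (s ^ k - / Q); have m1 := Rmax_r 0 (s ^ k - / Q).
  set m := Rmax _ _ in m0 m1 *.
  suff : z / (Q - z) * ((f * Q - 1) / (Q - 1)) <= c * (2 * m) by lra.
  apply: (Rle_trans _ (z / (Q - z) * (2 * m))); last by apply: Rmult_le_compat_r; lra.
  apply: Rmult_le_compat_l => //; apply/Rle_div_l; first lra.
  have : f * Q - 1 <= m * Q.
    have -> : f * Q - 1 = (f - / Q) * Q by field; lra.
    by apply: Rmult_le_compat_r; lra.
  nra.
Qed.

(* The three summands dominate, respectively, the range of agreements [S] near and below
   the mean [n / d], the intermediate range, and the linear range [S >= 2 n / (eta ln d)]. *)
Lemma pair_ratio_pow_le (n k d q t S : nat) (p r y : R) :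
  (1 < k)%N -> (k <= n)%N -> (S <= n)%N -> (1 < d)%N -> (q < d ^ k)%N -> 0 < p < 1 -> 0 < r ->
  INR q <= p * INR (d ^ k)%N -> INR t <= r * INR n * ln (INR d) -> / INR d <= y ->
  let c := p / (1 - p) in
  let eta := 1 - r * ln (1 + c) in
  0 < eta -> (1 + c) * ln (1 + c) / c <= INR k ->
  let B := 2 * c * r / eta in
  let A := 2 * c * r * ln (INR d) * (INR k * y ^ k.-1) in
  pair_ratio n k (d ^ k) q S ^ t <=
    Rmax 1 (exp (A * (INR S - INR n / INR d))) + exp ((1 + B) * INR S - INR n * y)
    + INR d ^ S * exp (- (2 * INR n)).
Proof.
move=> k1 kn Sn d1 qN [p0 p1] r0 qp tn ay c eta eta0 Hk B A.
have n0 : (0 < n)%N by apply: leq_trans kn; apply: ltnW.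
have N1 : (1 < d ^ k)%N by rewrite -{1}(exp1n k) ltn_exp2r // ltnW.
have [P0 [P1 P2]] := pair_ratio_bounds n k (d ^ k) q S p n0 kn Sn N1 qN p1 qp.
rewrite -/c in P1 P2; set rho := pair_ratio _ _ _ _ _ in P0 P1 P2 *.
set s := INR S / INR n in P1 P2.
have N0 : 0 < INR n by apply: (ltn_INR 0).
have d2 : 2 <= INR d by apply: (leq_INR 2).
have L0 : 0 < ln (INR d) by rewrite -ln_1; apply: ln_increasing; lra.
have c0 : 0 < c by apply: Rdiv_lt_0_compat; lra.
have t0 := pos_INR t; have S0 := pos_INR S.
have SE : INR S = s * INR n by rewrite /s; field; lra.
have SN : INR S <= INR n by apply: leq_INR.
have s0 : 0 <= s by apply: Rdiv_le_0_compat.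
have s1 : s <= 1 by apply/Rle_div_l => //; lra.
have X1 := Rlt_le _ _ (exp_pos ((1 + B) * INR S - INR n * y)).
have X2 : 0 <= INR d ^ S * exp (- (2 * INR n)).
  by apply: Rmult_le_pos; [apply: pow_le; lra | apply/Rlt_le/exp_pos].
have X0 := Rmax_l 1 (exp (A * (INR S - INR n / INR d))).
have [sy|ys] := Rle_lt_dec s y.
  apply: (Rle_trans _ (Rmax 1 (exp (A * (INR S - INR n / INR d))))); last lra.
  have iN : / INR (d ^ k)%N = (/ INR d) ^ k by rewrite INR_expn pow_inv.
  have a0 : 0 < / INR d by apply: Rinv_0_lt_compat; lra.
  (* At or below the mean agreement the correlation is not positive and the ratio is at most [1];
     above it, [s^k - d^(-k)] is linearized. *)
  have [sa|as_] := Rle_lt_dec s (/ INR d).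
    have sk : s ^ k <= (/ INR d) ^ k by apply: pow_incr; lra.
    rewrite Rmax_left in P2; last by rewrite iN; lra.
    apply: Rle_trans X0; rewrite -(pow1 t); apply: pow_incr; lra.
  apply: Rle_trans (Rmax_r _ _).
  have sk : s ^ k - / INR (d ^ k)%N <= INR k * y ^ k.-1 * (s - / INR d).
    rewrite iN; have -> : k = k.-1.+1 by rewrite prednK // ltnW.
    by apply: pow_sub_le; lra.
  have Z0 : 0 <= INR k * y ^ k.-1 * (s - / INR d).
    apply: Rmult_le_pos; last lra.
    by apply: Rmult_le_pos; [apply: pos_INR | apply: pow_le; lra].
  set Z := INR k * y ^ k.-1 * (s - / INR d) in sk Z0.
  have PZ : rho <= 1 + 2 * c * Z.
    apply: Rle_trans P2 _; apply: Rplus_le_compat_l; apply: Rmult_le_compat_l; first lra.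
    exact: Rmax_lub.
  apply: (Rle_trans _ ((1 + 2 * c * Z) ^ t)); first by apply: pow_incr.
  apply: Rle_trans (pow_1p_le_exp _ _ _) _; first by nra.
  apply: exp_le.
  have -> : A * (INR S - INR n / INR d) = r * INR n * ln (INR d) * (2 * c * Z).
    by rewrite /A /Z SE; field; lra.
  by apply: Rmult_le_compat_r => //; nra.
have sp : 0 < s by apply: Rlt_trans ys; apply: Rlt_le_trans ay; apply: Rinv_0_lt_compat; lra.
have sk0 : 0 < s ^ k by apply: pow_lt.
have H : rho ^ t <= (1 + c * s ^ k) ^ t by apply: pow_incr.
(* In the intermediate range [s ln d <= 2 / eta] and [s^k <= s^2] give [t c s^k <= B S]; adding
   [S - n y > 0] to the exponent produces a bound summable over all [S]. *)
have [ss|ss] := Rle_lt_dec (s * (eta * ln (INR d))) 2.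
  apply: (Rle_trans _ (exp ((1 + B) * INR S - INR n * y))); last lra.
  apply: Rle_trans H _; apply: Rle_trans (pow_1p_le_exp _ _ _) _; first by nra.
  apply: exp_le.
  have : INR t * (c * s ^ k) <= B * INR S.
    have sk2 : s ^ k <= s * s.
      have -> : k = k.-2.+2 by case: (k) k1 => [|[]].
      have : s ^ k.-2 <= 1 by rewrite -(pow1 k.-2); apply: pow_incr; lra.
      by have := pow_le s k.-2 s0; rewrite /=; nra.
    apply: (Rle_trans _ (r * INR n * ln (INR d) * (c * (s * s)))).
      by apply: Rmult_le_compat => //; nra.
    rewrite /B SE.
    have -> : r * INR n * ln (INR d) * (c * (s * s)) =
      (r * INR n * c * s / eta) * (s * (eta * ln (INR d))) by field; lra.
    have -> : 2 * c * r / eta * (s * INR n) = (r * INR n * c * s / eta) * 2 by field; lra.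
    apply: Rmult_le_compat_l => //; apply: Rdiv_le_0_compat => //.
    apply: Rmult_le_pos => //; apply: Rmult_le_pos; last lra.
    by apply: Rmult_le_pos; lra.
  have : INR n * y <= INR S by rewrite SE; nra.
  lra.
(* In the linear range the power is at most [d^((1 - eta) S)], and [eta S ln d > 2 n] turns the
   saving into [exp (- 2 n)]. *)
apply: (Rle_trans _ (INR d ^ S * exp (- (2 * INR n)))); last lra.
apply: Rle_trans H _; rewrite (pow_exp_ln (1 + c * s ^ k)) ?(pow_exp_ln (INR d)); [|lra|nra].
rewrite -exp_plus; apply: exp_le.
have LL := ln_1p_pow_le k c s c0 Hk (conj sp s1).
have Lc : 0 <= ln (1 + c * s ^ k).
  by rewrite -ln_1; apply: ln_le; nra.
apply: (Rle_trans _ (r * INR n * ln (INR d) * (s * ln (1 + c)))).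
  by apply: Rmult_le_compat.
rewrite SE; have -> : r * INR n * ln (INR d) * (s * ln (1 + c)) =
  (1 - eta) * (s * INR n * ln (INR d)) by rewrite /eta; ring.
nra.
Qed.

(** * Averaging over the second assignment *)

Lemma sum_exp_agree (n d : nat) (g : {ffun 'I_n -> 'I_d}) (u v : R) : (0 < d)%N ->
  \Rsum_(h : {ffun 'I_n -> 'I_d}) exp (v * INR #|agree_set n d g h| + u)
  = exp u * (1 + (exp v - 1) / INR d) ^ n * INR d ^ n.
Proof.
move=> d0; have D0 : 0 < INR d by apply: (ltn_INR 0).
rewrite Rmult_assoc -Rpow_mult_distr.
have -> : (1 + (exp v - 1) / INR d) * INR d = INR d - 1 + exp v by field; lra.
rewrite -(sum_pow_agree _ _ g) -Rsum_mull; apply: eq_bigr => h _.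
by rewrite pow_exp exp_plus Rmult_comm [v * _]Rmult_comm.
Qed.

(** From [exp x <= 1 / (1 - x)] and [(1 - x) (1 + x + 2 x^2) = 1 + x^2 (1 - 2 x)]. *)
Lemma exp_le_quadratic (x : R) : 0 <= x <= 1 / 2 -> exp x <= 1 + x + 2 * x * x.
Proof.
move=> x0; rewrite -(Ropp_involutive x) exp_Ropp Ropp_involutive.
have H := exp_ineq1_le (- x).
apply: (Rle_trans _ (/ (1 - x))); first by apply: Rinv_le_contravar; lra.
rewrite -[X in X <= _]Rmult_1_l; apply/Rle_div_l; first lra.
have := Rmult_le_pos (x * x) (1 - 2 * x); nra.
Qed.

(* Jensen: the mean of [exp (v (X - a))] for a Bernoulli variable [X] of parameter [a]. *)
Lemma bernoulli_mgf_ge (a v : R) : 0 <= a <= 1 -> 1 <= exp (- (v * a)) * (1 + (exp v - 1) * a).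
Proof.
move=> a01; have -> : exp (- (v * a)) * (1 + (exp v - 1) * a) =
   (1 - a) * exp (- (v * a)) + a * exp (v * (1 - a)).
  have -> : v * (1 - a) = v + - (v * a) by ring.
  by rewrite exp_plus; ring.
have := exp_ineq1_le (- (v * a)); have := exp_ineq1_le (v * (1 - a)).
nra.
Qed.

(** Replaces the maximum by a quadratic in [z]. For [z] exponential in the agreement, its mean needs
    only the generating function at two points. *)
Lemma Rmax_1_le (z e : R) : 0 < e -> Rmax 1 z <= 1 + e + (z - 1) ^ 2 / e.
Proof.
move=> e0; have H : z - 1 <= e + (z - 1) ^ 2 / e.
  apply: (Rmult_le_reg_r e) => //.
  have -> : (e + (z - 1) ^ 2 / e) * e = e * e + (z - 1) ^ 2 by field; lra.
  by have := pow2_ge_0 (z - 1 - e); nra.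
have H0 : 0 <= (z - 1) ^ 2 / e by apply: Rdiv_le_0_compat => //; apply: pow2_ge_0.
by apply: Rmax_lub; lra.
Qed.

Lemma prob_sat_ge_explicit (n k d q t : nat) (p r y e : R) :
  (1 < k)%N -> (k <= n)%N -> (1 < d)%N -> (q < d ^ k)%N -> 0 < p < 1 -> 0 < r ->
  INR q <= p * INR (d ^ k)%N -> INR t <= r * INR n * ln (INR d) -> / INR d <= y ->
  let c := p / (1 - p) in
  let eta := 1 - r * ln (1 + c) in
  0 < eta -> (1 + c) * ln (1 + c) / c <= INR k ->
  let B := 2 * c * r / eta in
  let A := 2 * c * r * ln (INR d) * (INR k * y ^ k.-1) in
  A <= / 4 -> 0 < e ->
  2 - (1 + e + (exp (8 * (INR n / INR d) * A ^ 2) - 1) / e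
       + exp (INR n / INR d * (exp (1 + B) - 1) - INR n * y) + exp (- INR n))
  <= prob_sat n d k q t.
Proof.
move=> k1 kn d1 qN p01 r0 qp tn ay c eta eta0 Hk B A A4 e0.
have N1 : (1 < d ^ k)%N by rewrite -{1}(exp1n k) ltn_exp2r // ltnW.
apply: prob_sat_ge => // g.
have d0 : (0 < d)%N by apply: ltnW.
have d2 : 2 <= INR d by apply: (leq_INR 2).
have a0 : 0 < / INR d by apply: Rinv_0_lt_compat; lra.
have a1 : / INR d <= 1 by rewrite -Rinv_1; apply: Rinv_le_contravar; lra.
have Dn : 0 < INR d ^ n by apply: pow_lt; lra.
have L0 : 0 < ln (INR d) by rewrite -ln_1; apply: ln_increasing; lra.
have c0 : 0 < c by apply: Rdiv_lt_0_compat; lra.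
have A0 : 0 <= A.
  apply: Rmult_le_pos; first by apply: Rmult_le_pos; nra.
  by apply: Rmult_le_pos; [apply: pos_INR | apply: pow_le; lra].
pose m := INR n / INR d.
(* [Zs j] is the mean of [exp (j A (S - n / d))]. Since [Zs 1] enters with coefficient [- 2 / e], it
   needs a lower bound, while [Zs 2] needs an upper bound. *)
pose Zs (j : R) := exp (- (j * A * m)) * (1 + (exp (j * A) - 1) / INR d) ^ n.
have Z1 : 1 <= Zs 1.
  rewrite /Zs !Rmult_1_l; have -> : - (A * m) = INR n * - (A * / INR d).
    by rewrite /m; field; lra.
  rewrite -pow_exp -Rpow_mult_distr; rewrite -{1}(pow1 n); apply: pow_incr; split; first lra.
  by apply: bernoulli_mgf_ge; lra.
have Z2 : Zs 2 <= exp (8 * m * A ^ 2).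
  (* [A <= 1/4] allows the quadratic bound at [2 A]; its linear part cancels against the centring
     factor and leaves [8 m A^2]. *)
  have X : exp (2 * A) - 1 <= 2 * A + 8 * A ^ 2.
    by have := exp_le_quadratic (2 * A) ltac:(lra); nra.
  have X0 : 0 <= exp (2 * A) - 1 by have := exp_ineq1_le (2 * A); lra.
  have Y : (1 + (exp (2 * A) - 1) / INR d) ^ n <= exp (INR n * ((exp (2 * A) - 1) / INR d)).
    by apply: pow_1p_le_exp; have : 0 <= (exp (2 * A) - 1) / INR d;
      [apply: Rdiv_le_0_compat | ]; lra.
  apply: Rle_trans (Rmult_le_compat_l _ _ _ (Rlt_le _ _ (exp_pos _)) Y) _.
  rewrite -exp_plus; apply: exp_le.
  have -> : INR n * ((exp (2 * A) - 1) / INR d) = m * (exp (2 * A) - 1) by rewrite /m; field; lra.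
  have m0 : 0 <= m by apply: Rdiv_le_0_compat; [apply: pos_INR | lra].
  by have := Rmult_le_compat_l m _ _ m0 X; lra.
pose T1 S := exp (1 * A * INR S + - (1 * A * m)).
pose T2 S := exp (2 * A * INR S + - (2 * A * m)).
pose T3 S := exp ((1 + B) * INR S + - (INR n * y)).
pose T4 S := exp (ln (INR d) * INR S + - (2 * INR n)).
apply: (Rle_trans _ (\Rsum_(h : {ffun 'I_n -> 'I_d}) let S := #|agree_set n d g h| in
   ((1 + e + / e) + (- (2 / e)) * T1 S + / e * T2 S + T3 S + T4 S))).
  apply: Rsum_le => h _; cbv beta zeta; set S := #|_|.
  have Sn : (S <= n)%N by rewrite -[leqRHS](card_ord n) max_card.
  have := pair_ratio_pow_le n k d q t S p r y k1 kn Sn d1 qN p01 r0 qp tn ay eta0 Hk.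
  rewrite -/c -/eta -/B -/A -/m => /Rle_trans; apply.
  have -> : INR d ^ S * exp (- (2 * INR n)) = T4 S.
    by rewrite pow_exp_ln -?exp_plus; [congr exp; ring | lra].
  have := Rmax_1_le (T1 S) e e0.
  have -> : T1 S = exp (A * (INR S - m)) by congr exp; ring.
  have -> : T2 S = exp (A * (INR S - m)) ^ 2 by rewrite pow_exp; congr exp; rewrite /=; ring.
  have -> : T3 S = exp ((1 + B) * INR S - INR n * y) by [].
  set w := exp _; have -> : (w - 1) ^ 2 / e = / e + - (2 / e) * w + / e * w ^ 2 by field; lra.
  lra.
rewrite /= !big_split /= !Rsum_mull !Rsum_const /T1 /T2 /T3 /T4 !sum_exp_agree //.
rewrite card_ffun !card_ord INR_expn exp_ln; last lra.
rewrite -/(Zs 1) -/(Zs 2).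
set G3 := exp (- (INR n * y)) * _; set G4 := exp (- (2 * INR n)) * _.
have H3 : G3 <= exp (INR n / INR d * (exp (1 + B) - 1) - INR n * y).
  rewrite /Rminus Rplus_comm exp_plus; apply: Rmult_le_compat_l; first exact/Rlt_le/exp_pos.
  have -> : INR n / INR d * (exp (1 + B) + - (1)) = INR n * ((exp (1 + B) - 1) / INR d).
    by field; lra.
  apply: pow_1p_le_exp; have := exp_pos (1 + B) => E.
  by apply/Rle_div_r; lra.
have H4 : G4 <= exp (- INR n).
  (* The generating function at [z = d] is [(2 - 1/d)^n <= exp n], which uses up half of the factor
     [exp (- 2 n)]. *)
  have -> : - INR n = - (2 * INR n) + INR n * 1 by ring.
  rewrite exp_plus; apply: Rmult_le_compat_l; first exact/Rlt_le/exp_pos.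
  rewrite -pow_exp; apply: pow_incr.
  have -> : 1 + (INR d - 1) / INR d = 2 - / INR d by field; lra.
  by have := exp_ineq1_le 1; lra.
have ie : 0 < / e by apply: Rinv_0_lt_compat.
have -> : (exp (8 * (INR n / INR d) * A ^ 2) - 1) / e = / e * exp (8 * m * A ^ 2) - / e.
  by rewrite /m; field; lra.
have : / e * Zs 2 <= / e * exp (8 * m * A ^ 2) by apply: Rmult_le_compat_l; lra.
have : / e * 1 <= / e * Zs 1 by apply: Rmult_le_compat_l; lra.
have -> : 2 / e = 2 * / e by [].
move=> H1 H2; set E3 := exp (_ - INR n * y) in H3 *.
have := Rmult_le_compat_r (INR d ^ n)
  (1 + e + / e + - (2 * / e) * Zs 1 + / e * Zs 2 + G3 + G4)
  (1 + e + (/ e * exp (8 * m * A ^ 2) - / e) + E3 + exp (- INR n)) (Rlt_le _ _ Dn).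
lra.
Qed.

(** * Asymptotics *)

Lemma floor_bounds (z : R) : 0 <= z ->
  INR (Z.to_nat (Int_part z)) <= z < INR (Z.to_nat (Int_part z)) + 1.
Proof.
move=> z0; have [H1 H2] := base_Int_part z.
have H3 : (0 <= Int_part z)%Z.
  by apply/Z.lt_succ_r/lt_IZR; rewrite succ_IZR; lra.
by rewrite INR_IZR_INZ Z2Nat.id //; lra.
Qed.

Lemma Rpower_gt0 (x a : R) : 0 < Rpower x a.
Proof. exact: exp_pos. Qed.

Lemma eventually_INR_ge (b : R) : eventually (fun n => b <= INR n).
Proof.
have [M HM] := nfloor_ex (Rmax 1 b) ltac:(have := Rmax_l 1 b; lra).
exists M.+1 => n /le_INR; rewrite S_INR => H; have := Rmax_r 1 b; lra.
Qed.

Lemma eventually_and (P Q : nat -> Prop) :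
  eventually P -> eventually Q -> eventually (fun n => P n /\ Q n).
Proof. exact: filter_and. Qed.

Lemma eventually_Rpower_ge (a b : R) : 0 < a -> eventually (fun n => b <= Rpower (INR n) a).
Proof.
move=> a0; have m1 := Rmax_l 1 b; have mb := Rmax_r 1 b.
apply: filter_imp (eventually_INR_ge (Rpower (Rmax 1 b) (/ a))) => n H.
apply: Rle_trans mb _.
have -> : Rmax 1 b = Rpower (Rpower (Rmax 1 b) (/ a)) a.
  by rewrite Rpower_mult Rinv_l ?Rpower_1; lra.
apply: Rle_Rpower_l; first lra.
by split=> //; apply: Rpower_gt0.
Qed.

Lemma eventually_Rpower_le (a e : R) : a < 0 -> 0 < e ->
  eventually (fun n => Rpower (INR n) a <= e).
Proof.
move=> a0 e0; apply: filter_imp (eventually_Rpower_ge (- a) (/ e) _) => [n H|]; last lra.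
rewrite -(Ropp_involutive a) Rpower_Ropp -(Rinv_inv e).
by apply: Rinv_le_contravar => //; apply: Rinv_0_lt_compat.
Qed.

Lemma ln_le_Rpower (x a : R) : 0 < a -> ln x <= Rpower x a / a.
Proof.
move=> a0; apply/Rle_div_r => //; rewrite /Rpower Rmult_comm.
by have := exp_ineq1_le (a * ln x); lra.
Qed.

Lemma dRB_bounds (alpha : R) : 0 < alpha -> eventually (fun n =>
  2 <= INR (dRB n alpha) /\ Rpower (INR n) alpha / 2 <= INR (dRB n alpha) /\
  INR (dRB n alpha) <= Rpower (INR n) alpha).
Proof.
move=> a0; apply: filter_imp (eventually_Rpower_ge alpha 3 a0) => n H.
have [H1 H2] : _ /\ _ := floor_bounds (Rpower (INR n) alpha) ltac:(lra).
rewrite -/(dRB n alpha) in H1 H2.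
have H3 : (1 < dRB n alpha)%N.
  rewrite ltnNge; apply/negP => /leq_INR; rewrite /=; lra.
have : 2 <= INR (dRB n alpha) by apply: (leq_INR 2).
lra.
Qed.

Lemma prob_satRB_ge (k : nat) (alpha r p e : R) :
  (1 < k)%N -> 0 < alpha -> 0 < r -> 0 < p < 1 ->
  1 < (2 * INR k - 1) * alpha ->
  let c := p / (1 - p) in
  r * ln (1 + c) < 1 -> (1 + c) * ln (1 + c) / c <= INR k -> 0 < e < 1 ->
  eventually (fun n => 1 - 4 * e <= prob_satRB n alpha r k p).
Proof.
move=> k1 a0 r0 p01 ak c rc Hk e01.
set K := INR k in ak Hk.
have K2 : 2 <= K by apply: (leq_INR 2).
have c0 : 0 < c by apply: Rdiv_lt_0_compat; lra.
have eta0 : 0 < 1 - r * ln (1 + c) by lra.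
set eta := 1 - r * ln (1 + c) in eta0.
(* Capping at [1] keeps [n^(1 - be) >= 1], so that [n y = n^(1 - be + de)] tends to infinity even
   when [alpha > 1]. *)
pose be := Rmin alpha 1.
have be_a : be <= alpha := Rmin_l _ _.
have be_1 : be <= 1 := Rmin_r _ _.
have be0 : 0 < be by apply: Rmin_glb_lt; lra.
(* [g] is the margin available in both exponents below. For [alpha <= 1] its second entry is
   [(2 k - 1) alpha - 1]; for [alpha > 1] positivity follows from [k >= 2]. *)
pose g := Rmin (be * (K - 1)) (alpha + 2 * be * (K - 1) - 1).
have g0 : 0 < g.
  apply: Rmin_glb_lt; first nra.
  rewrite /be; case: (Rle_dec alpha 1) => H.
    by rewrite (Rmin_left alpha 1); nra.
  by rewrite (Rmin_right alpha 1); nra.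
have g1 : g <= be * (K - 1) := Rmin_l _ _.
have g2 : g <= alpha + 2 * be * (K - 1) - 1 := Rmin_r _ _.
(* With [de K = g / 4], the exponent [e1] of [A] is at most [- 3 g / 4], and the exponent
   [1 - alpha + 2 e1] of [(n / d) A^2] is at most [- g / 2]. *)
pose de := g / (4 * K).
have de0 : 0 < de by apply: Rdiv_lt_0_compat; lra.
have deK : de * K = g / 4 by rewrite /de; field; lra.
pose e1 := de + (de - be) * (K - 1).
have e1E : e1 = g / 4 - be * (K - 1) by rewrite /e1 -deK; ring.
pose B := 2 * c * r / eta; pose E := exp (1 + B) - 1.
(* The factor [alpha / de] comes from [ln d <= alpha ln n <= (alpha / de) n^de], giving
   [A <= C n^e1]. *)
pose C := 2 * c * r * K * (alpha / de).
have C0 : 0 < C.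
  by apply: Rmult_lt_0_compat; [apply: Rmult_lt_0_compat; nra | apply: Rdiv_lt_0_compat].
have l0 : 0 < ln (1 + e * e) by rewrite -ln_1; apply: ln_increasing; nra.
have F1 := eventually_Rpower_le e1 (/ (4 * C)) ltac:(lra) ltac:(apply: Rinv_0_lt_compat; lra).
have F2 := eventually_Rpower_le (1 - alpha + 2 * e1) (ln (1 + e * e) / (16 * C ^ 2)) ltac:(lra)
  ltac:(apply: Rdiv_lt_0_compat => //; nra).
have F3 := eventually_Rpower_ge de (Rmax 2 (2 * E - ln e)) de0.
have F4 := eventually_INR_ge (Rmax (Rmax 1 K) (- ln e)).
have F5 := dRB_bounds alpha a0.
have FF := eventually_and _ _ F1 (eventually_and _ _ F2 (eventually_and _ _ F3 (eventually_and _ _ F4 F5))).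
apply: filter_imp FF => n {F1 F2 F3 F4 F5} [F1 [F2 [F3 [F4 [d2 [dl du]]]]]].
set d := dRB n alpha in d2 dl du; set x := INR n in F1 F2 F3 F4 dl du.
have x1 : 1 <= x by move: F4; rewrite -/x; have := Rmax_l 1 K; have := Rmax_l (Rmax 1 K) (- ln e); lra.
have kx : K <= x by move: F4; rewrite -/x; have := Rmax_r 1 K; have := Rmax_l (Rmax 1 K) (- ln e); lra.
have xe : - ln e <= x by have := Rmax_r (Rmax 1 K) (- ln e); lra.
have xd2 : 2 <= Rpower x de by have := Rmax_l 2 (2 * E - ln e); lra.
have xdE : 2 * E - ln e <= Rpower x de by have := Rmax_r 2 (2 * E - ln e); lra.
pose y := Rpower x (de - be).
have Pmono a b : a <= b -> Rpower x a <= Rpower x b.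
  by move=> ab; apply: exp_le; apply: Rmult_le_compat_r => //; rewrite -ln_1; apply: ln_le; lra.
have P0 a : 0 < Rpower x a := Rpower_gt0 x a.
have lnx0 : 0 <= ln x by rewrite -ln_1; apply: ln_le; lra.
have lnd0 : 0 < ln (INR d) by rewrite -ln_1; apply: ln_increasing; lra.
have lnd : ln (INR d) <= alpha / de * Rpower x de.
  apply: (Rle_trans _ (alpha * ln x)).
    by rewrite -[alpha * ln x]ln_exp; apply: ln_le; [lra | exact: du].
  have := ln_le_Rpower x de de0 => H.
  have := Rmult_le_compat_l alpha _ _ (Rlt_le _ _ a0) H; rewrite /Rdiv; lra.
have id : / INR d <= 2 * Rpower x (- alpha).
  rewrite Rpower_Ropp; have -> : 2 * / Rpower x alpha = / (Rpower x alpha / 2).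
    by field; have := P0 alpha; lra.
  by apply: Rinv_le_contravar => //; have := P0 alpha; lra.
(* Rounding [d] down costs a factor [2], absorbed by [n^de >= 2]. *)
have yd : / INR d <= y.
  apply: Rle_trans id _; rewrite /y /Rminus Rpower_plus.
  have := Pmono (- alpha) (- be) ltac:(lra).
  by have := P0 (- alpha); have := P0 (- be); nra.
have md : x / INR d <= 2 * Rpower x (1 - alpha).
  rewrite /Rminus Rpower_plus Rpower_1; last lra.
  by rewrite /Rdiv; nra.
have dN : INR (d ^ k)%N = INR d ^ k by rewrite INR_expn.
have dk0 : 0 < INR (d ^ k)%N by rewrite dN; apply: pow_lt; lra.
have [q1 q2] := floor_bounds (p * INR (d ^ k)%N) ltac:(nra).
have t0 : 0 <= r * x * ln (INR d) by apply: Rmult_le_pos; nra.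
have [t1 t2] := floor_bounds (r * x * ln (INR d)) t0.
pose A := 2 * c * r * ln (INR d) * (INR k * y ^ k.-1).
have AC : A <= C * Rpower x e1.
  rewrite /A; have -> : y ^ k.-1 = Rpower x ((de - be) * (K - 1)).
    rewrite /y -Rpower_pow ?Rpower_mult; last exact: P0.
    congr (Rpower _ (_ * _)); rewrite /K; have -> : k = k.-1.+1 by rewrite prednK // ltnW.
    by rewrite S_INR /=; ring.
  rewrite /e1 Rpower_plus /C -/K.
  have := P0 ((de - be) * (K - 1)); set w := Rpower x (_ * _) => w0.
  have -> : 2 * c * r * K * (alpha / de) * (Rpower x de * w) =
    2 * c * r * (alpha / de * Rpower x de) * (K * w) by ring.
  apply: Rmult_le_compat_r; first nra.
  by apply: Rmult_le_compat_l => //; nra.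
have A0 : 0 <= A.
  apply: Rmult_le_pos; first by apply: Rmult_le_pos; nra.
  by apply: Rmult_le_pos; [apply: pos_INR | apply/pow_le/Rlt_le/P0].
have A4 : A <= / 4.
  apply: Rle_trans AC _; have := Rmult_le_compat_l C _ _ (Rlt_le _ _ C0) F1.
  by have -> : C * / (4 * C) = / 4 by field; lra.
have kn : (k <= n)%N by apply/leP/INR_le.
have d1 : (1 < d)%N by rewrite ltnNge; apply/negP => /leq_INR; rewrite /=; lra.
have qN : (qRB n alpha k p < d ^ k)%N.
  rewrite ltnNge; apply/negP => /leq_INR; rewrite /qRB -/d; nra.
have H := prob_sat_ge_explicit n k d (qRB n alpha k p) (tRB n alpha r) p r y e
  k1 kn d1 qN p01 r0 q1 t1 yd eta0 Hk A4 (proj1 e01).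
apply: Rle_trans H; rewrite -/c -/eta -/B -/A -/x -/E.
have Le : exp (- x) <= e by rewrite -[X in _ <= X](exp_ln e); [apply: exp_le; lra | lra].
have L8 : (exp (8 * (x / INR d) * A ^ 2) - 1) / e <= e.
  apply/Rle_div_l; first lra.
  suff : exp (8 * (x / INR d) * A ^ 2) <= 1 + e * e by lra.
  rewrite -[X in _ <= X](exp_ln (1 + e * e)); last nra.
  apply: exp_le.
  have A2 : A ^ 2 <= C ^ 2 * Rpower x (2 * e1).
    have -> : 2 * e1 = e1 + e1 by ring.
    rewrite Rpower_plus; have -> : C ^ 2 * (Rpower x e1 * Rpower x e1) = (C * Rpower x e1) ^ 2.
      by ring.
    by apply: pow_incr; lra.
  apply: (Rle_trans _ (16 * C ^ 2 * Rpower x (1 - alpha + 2 * e1))).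
    rewrite Rpower_plus.
    have -> : 16 * C ^ 2 * (Rpower x (1 - alpha) * Rpower x (2 * e1)) =
      8 * (2 * Rpower x (1 - alpha)) * (C ^ 2 * Rpower x (2 * e1)) by ring.
    have m0 : 0 <= x / INR d by apply: Rdiv_le_0_compat; lra.
    by apply: Rmult_le_compat => //; [lra | apply: pow2_ge_0 | lra].
  by move/Rle_div_r: F2 => F2; have := F2 ltac:(nra); lra.
(* The exponent is at most [n^(1 - be) (2 E - n^de) <= n^(1 - be) ln e <= ln e]. *)
have LE : exp (x / INR d * E - x * y) <= e.
  rewrite -[X in _ <= X](exp_ln e); last lra.
  apply: exp_le.
  have E0 : 0 < E.
    have B0 : 0 < B by apply: Rdiv_lt_0_compat => //; nra.
    by have := exp_ineq1_le (1 + B); rewrite /E; lra.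
  have H1 := Pmono (1 - alpha) (1 - be) ltac:(lra).
  have H2 : x / INR d * E <= 2 * Rpower x (1 - be) * E by apply: Rmult_le_compat_r; lra.
  have H3 : x * y = Rpower x (1 - be) * Rpower x de.
    rewrite -{1}(Rpower_1 x) /y -?Rpower_plus; [congr Rpower; ring | lra].
  have H4 : 1 <= Rpower x (1 - be).
    by rewrite -[X in X <= _](Rpower_O x); [apply: Pmono; lra | lra].
  have le0 : ln e <= 0 by rewrite -ln_1; apply: ln_le; lra.
  rewrite H3.
  have := Rmult_le_compat_l _ _ _ (Rlt_le _ _ (P0 (1 - be))) xdE.
  have : Rpower x (1 - be) * (- ln e) >= - ln e by nra.
  nra.
lra.
Qed.

Lemma prob_satRB_le (k : nat) (alpha r p e : R) :
  (0 < k)%N -> 0 < alpha -> 0 < r -> 0 < p < 1 -> 1 < r * - ln (1 - p) -> 0 < e ->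
  eventually (fun n => prob_satRB n alpha r k p <= e).
Proof.
move=> k0 a0 r0 p01 rp e0.
(* A midpoint: [L < - ln (1 - p)] leaves room for rounding [q] down, while [L > 1 / r] keeps
   [r L > 1]. *)
pose L := (/ r + - ln (1 - p)) / 2.
have ir : r * / r = 1 by field; lra.
have ir0 : 0 < / r by apply: Rinv_0_lt_compat.
have rl : / r < - ln (1 - p) by apply: (Rmult_lt_reg_l r) => //; lra.
have L0 : 0 < L by rewrite /L; lra.
have rL : 0 < r * L - 1 by rewrite /L; nra.
have u0 : 0 < exp (- L) - (1 - p).
  rewrite -[X in _ - X]exp_ln; last lra.
  by have := exp_increasing (ln (1 - p)) (- L); rewrite /L; lra.
set u := exp (- L) in u0.
have l2 : 0 < ln 2 by rewrite -ln_1; apply: ln_increasing; lra.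
(* Since [t > r n ln d - 1], the final exponent [n ln d - t L] is at most [L - (r L - 1) n ln d];
   this size of [n], with [d >= 2], brings it below [ln e]. *)
have F1 := eventually_INR_ge (Rmax (INR k) ((L - ln e) / (r * L - 1) / ln 2)).
have F2 := dRB_bounds alpha a0.
have F3 := eventually_Rpower_ge alpha (2 / (u - (1 - p))) a0.
have FF := eventually_and _ _ F1 (eventually_and _ _ F2 F3).
apply: filter_imp FF => n {F1 F2 F3} [F1 [[d2 [dl du]] F3]].
have nk : INR k <= INR n by apply: Rle_trans F1; apply: Rmax_l.
have nL : (L - ln e) / (r * L - 1) / ln 2 <= INR n by apply: Rle_trans F1; apply: Rmax_r.
set d := dRB n alpha in d2 dl du.
have dk : INR d <= INR (d ^ k)%N.
  apply: leq_INR; rewrite -{1}(expn1 d) leq_pexp2l //.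
  by apply/ltP/INR_lt; rewrite /=; lra.
have iN : / INR (d ^ k)%N <= u - (1 - p).
  have -> : u - (1 - p) = / (2 / (u - (1 - p)) / 2) by field; lra.
  apply: Rinv_le_contravar; last lra.
  by apply: Rdiv_lt_0_compat; [apply: Rdiv_lt_0_compat | ]; lra.
have [q1 q2] := floor_bounds (p * INR (d ^ k)%N) ltac:(nra).
have lnd : ln 2 <= ln (INR d) by apply: ln_le; lra.
have n0 := pos_INR n.
have t0 : 0 <= r * INR n * ln (INR d) by apply: Rmult_le_pos; nra.
have [t1 t2] := floor_bounds (r * INR n * ln (INR d)) t0.
have kn : (k <= n)%N by apply/leP/INR_le.
rewrite -/(qRB n alpha k p) in q1 q2; rewrite -/(tRB n alpha r) in t1 t2.
set q := qRB n alpha k p in q1 q2; set t := tRB n alpha r in t1 t2.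
have qN : (q < d ^ k)%N by rewrite ltnNge; apply/negP => /leq_INR; nra.
apply: Rle_trans (prob_sat_le n d k q t kn qN) _.
have Q0 : 0 <= 1 - INR q / INR (d ^ k)%N.
  suff : INR q / INR (d ^ k)%N <= 1 by lra.
  by apply/Rle_div_l; [lra | have := ltn_INR _ _ qN; lra].
have Qu : 1 - INR q / INR (d ^ k)%N <= u.
  suff : p - / INR (d ^ k)%N <= INR q / INR (d ^ k)%N by lra.
  apply/Rle_div_r; first lra.
  have : (p - / INR (d ^ k)%N) * INR (d ^ k)%N = p * INR (d ^ k)%N - 1 by field; lra.
  lra.
have H : (1 - INR q / INR (d ^ k)%N) ^ t <= u ^ t by apply: pow_incr.
apply: Rle_trans (Rmult_le_compat_l _ _ _ _ H) _; first by apply: pow_le; lra.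
rewrite (pow_exp_ln (INR d)); last lra.
rewrite /u pow_exp -exp_plus -[X in _ <= X](exp_ln e) //; apply: exp_le.
have : (L - ln e) / (r * L - 1) <= INR n * ln (INR d).
  move/(Rle_div_l _ _ _ l2): nL => nL; apply: Rle_trans nL _.
  exact: Rmult_le_compat_l.
move/(Rle_div_l _ _ _ rL).
have := Rmult_le_compat_r L _ _ (Rlt_le _ _ L0) (Rlt_le _ _ t2).
lra.
Qed.

Lemma prob_sat_01 (n d k q t : nat) : 0 <= prob_sat n d k q t <= 1.
Proof.
rewrite /prob_sat; set a := #|_|; set b := #|_|.
have ab : (a <= b)%N by apply/subset_leq_card/subsetP => I; rewrite !inE => /andP[].
(* Without valid instances the numerator vanishes too, so the quotient is [0] whatever the value of
   [/ 0]. *)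
have [b0|b0] := posnP b.
  by move: ab; rewrite b0 leqn0 => /eqP ->; rewrite /Rdiv Rmult_0_l; lra.
have B0 : 0 < INR b by apply: (ltn_INR 0).
split; first by apply: Rdiv_le_0_compat => //; apply: pos_INR.
by apply/Rle_div_l => //; rewrite Rmult_1_l; apply: leq_INR.
Qed.

Theorem theorem3p1 (k : nat) (alpha r p : R) :
  (2 <= k)%N -> 0 < alpha -> 0 < r -> 0 < p -> p < 1 ->
  let tau := / (1 - p) in
  let rcr := / ln tau in
  Rlt 1 ((2 * INR k - 1) * alpha) ->
  Rle (tau * ln tau / (tau - 1)) (INR k) ->
  (r < rcr -> is_lim_seq (fun n => prob_satRB n alpha r k p) (Rbar.Finite 1)) /\
  (rcr < r -> is_lim_seq (fun n => prob_satRB n alpha r k p) (Rbar.Finite 0)).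
Proof.
move=> k2 a0 r0 p0 p1 tau rcr ak Hk.
have tauE : tau = 1 + p / (1 - p) by rewrite /tau; field; lra.
have c0 : 0 < p / (1 - p) by apply: Rdiv_lt_0_compat; lra.
have lt0 : 0 < ln tau by rewrite -ln_1; apply: ln_increasing; lra.
have P01 n : 0 <= prob_satRB n alpha r k p <= 1 := prob_sat_01 _ _ _ _ _.
split=> rr; apply/is_lim_seq_spec => eps; have eps0 := cond_pos eps.
(* The loss [4 e] is at most [eps / 2], and the cap [1/2] ensures [e < 1]. *)
- pose e := Rmin (eps / 8) (/ 2).
  have e1 : e <= eps / 8 := Rmin_l _ _.
  have e2 : e <= / 2 := Rmin_r _ _.
  have e0 : 0 < e by apply: Rmin_glb_lt; lra.
  have rt : r * ln tau < 1.
    by have := Rmult_lt_compat_r _ _ _ lt0 rr; rewrite /rcr Rinv_l; lra.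
  have Hk' : (1 + p / (1 - p)) * ln (1 + p / (1 - p)) / (p / (1 - p)) <= INR k.
    by move: Hk; rewrite tauE; have -> : 1 + p / (1 - p) - 1 = p / (1 - p) by ring.
  rewrite tauE in rt.
  apply: filter_imp (prob_satRB_ge k alpha r p e k2 a0 r0 (conj p0 p1) ak rt Hk' _) => [n H|];
    last lra.
  by apply: Rabs_def1; have := P01 n; lra.
- have rt : 1 < r * - ln (1 - p).
    have -> : - ln (1 - p) = ln tau by rewrite /tau ln_Rinv; lra.
    by have := Rmult_lt_compat_r _ _ _ lt0 rr; rewrite /rcr Rinv_l; lra.
  apply: filter_imp (prob_satRB_le k alpha r p (eps / 2) (ltnW k2) a0 r0 (conj p0 p1) rt _) => [n H|];
    last lra.
  by apply: Rabs_def1; have := P01 n; lra.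
Qed.
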